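(* Let $\mathcal{H}$ be an infinite-dimensional separable Hilbert space and let $(f_n)$ and $(g_n)$ be sequences in $\mathcal{H}$ such that $\inf_n\|f_n\|\|g_n\|>0$ or $(g_n)$ is minimal or $(f_n)$ is minimal. The following statements are equivalent. 1. For every $f\in\mathcal{H}$, $f=\sum_n\langle f,f_n\rangle g_n$ with unconditional convergence. 2. $g_n\neq0$ for every $n$, and $(\|g_n\|f_n)$ and $(\|g_n\|^{-1}g_n)$ are dual frames for $\mathcal{H}$. 3. $f_n\neq0$ for every $n$, and $(\|f_n\|g_n)$ and $(\|f_n\|^{-1}f_n)$ are dual frames for $\mathcal{H}$.
   Context: All sequences are indexed by $\mathbb{N}$. A sequence $(f_n)$ in $\mathcal{H}$ is minimal if $f_j\notin\overline{\mathrm{span}}(f_n)_{n\neq j}$ for all $j$. A sequence $(h_n)$ in $\mathcal{H}$ is a frame for $\mathcal{H}$ if there are $A,B\in(0,\infty)$ with $A\|f\|^2\le\sum_n|\langle f,h_n\rangle|^2\le B\|f\|^2$ for all $f\in\mathcal{H}$. Two sequences $(h_n)$ and $(k_n)$ are dual frames for $\mathcal{H}$ if both are frames for $\mathcal{H}$ and $f=\sum_n\langle f,h_n\rangle k_n=\sum_n\langle f,k_n\rangle h_n$ for all $f\in\mathcal{H}$. *)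

(* Defs.v *)
From HB Require Import structures.
From mathcomp Require Import all_boot all_order all_algebra.
From mathcomp Require Import complex.
From mathcomp Require Import all_classical all_reals all_analysis.

Set Implicit Arguments.
Unset Strict Implicit.
Unset Printing Implicit Defensive.

Import Order.TTheory GRing.Theory Num.Theory.
Import numFieldNormedType.Exports.

Local Open Scope classical_set_scope.
Local Open Scope ring_scope.

Variant scalar_kind := RealScalars | ComplexScalars.

Definition scalar_field (R : realType) (k : scalar_kind) : numFieldType :=
  match k with RealScalars => R | ComplexScalars => R[i] end.

Definition scalar_conj (R : realType) (k : scalar_kind) :
    scalar_field R k -> scalar_field R k :=
  match k with RealScalars => idfun | ComplexScalars => @conjc R end.

Definition scalar_re (R : realType) (k : scalar_kind) : scalar_field R k -> R :=
  match k with RealScalars => idfun | ComplexScalars => @complex.Re R end.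

(* The library norm of a module over [scalar_field R k] is itself a nonnegative
   real element of [scalar_field R k]; [rnorm] is the same number as an element
   of [R]. For a scalar [x], [rnorm x] is the absolute value of [x]. *)
Definition rnorm (R : realType) (k : scalar_kind)
    (V : normedZmodType (scalar_field R k)) (x : V) : R := scalar_re `|x|.

(* Inner products are linear in the first variable and conjugate-linear in the
   second one. A Hilbert space over [scalar_field R k] is a
   [completeNormedModType (scalar_field R k)] with an inner product inducing its
   norm. *)
Definition induces_norm (R : realType) (k : scalar_kind)
    (H : normedModType (scalar_field R k)) (dot : {dot H for @scalar_conj R k}) :
    Prop :=
  forall x : H, `|x| ^+ 2 = dot x x.

Definition linear_span (K : numFieldType) (V : lmodType K) (A : set V) :
    set V :=
  [set x | exists (m : nat) (c : 'I_m -> K) (v : 'I_m -> V),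
     (forall i, A (v i)) /\ x = \sum_(i < m) c i *: v i].

Definition infinite_dimensional (K : numFieldType) (V : lmodType K) : Prop :=
  forall A : set V, finite_set A -> linear_span A <> setT.

Definition separable_space (T : topologicalType) : Prop :=
  exists2 A : set T, countable A & dense A.

Definition minimal_seq (K : numFieldType) (H : normedModType K) (f : nat -> H) :
    Prop :=
  forall j : nat, ~ closure (linear_span (f @` [set n | n != j])) (f j).

(* That the rearranged series all have the same sum [x] is a theorem, not part
   of the definition. *)
Definition unconditionally_sums_to (K : numFieldType) (H : normedModType K)
    (u : nat -> H) (x : H) : Prop :=
  series u @ \oo --> x /\
  forall s : nat -> nat, bijective s -> cvgn (series (u \o s)).

Definition frame (R : realType) (k : scalar_kind)
    (H : normedModType (scalar_field R k)) (dot : {dot H for @scalar_conj R k})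
    (h : nat -> H) : Prop :=
  exists A B : R, [/\ 0 < A, 0 < B & forall x : H,
    ((A * rnorm x ^+ 2)%:E <= \sum_(0 <= n <oo) (rnorm (dot x (h n)) ^+ 2)%:E
       <= (B * rnorm x ^+ 2)%:E)%E].

Definition dual_frames (R : realType) (k : scalar_kind)
    (H : normedModType (scalar_field R k)) (dot : {dot H for @scalar_conj R k})
    (h g : nat -> H) : Prop :=
  [/\ frame dot h, frame dot g & forall x : H,
    series (fun n => dot x (h n) *: g n) @ \oo --> x /\
    series (fun n => dot x (g n) *: h n) @ \oo --> x].

(* Main.v *)
(** A sequence has bounded finite partial sums (over arbitrary finite index sets)
    when all its rearrangements converge, by a gliding hump. Conversely, in a
    Hilbert space the parallelogram law lets one choose signs making the squared
    norm of a signed sum of blocks at least the sum of the squared norms of the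
    blocks; so bounded finite sums force the blocks to be square summable, hence
    every rearrangement to be Cauchy.

    If [f] and [g] reconstruct unconditionally, the uniform boundedness principle
    bounds the finite sums of [<x, f_n> g_n] by [C ||x||]. This bound passes to
    the adjoint sums of [<x, g_n> f_n], so [g] and [f] reconstruct as well, and
    blocks of length one give
    [sum |<x, f_n>|^2 ||g_n||^2, sum |<x, g_n>|^2 ||f_n||^2 <= 4 C^2 ||x||^2].
    Together with a lower bound on [||f_n|| ||g_n||] these are the Bessel bounds
    of the normalized sequences; lower frame bounds follow from reconstruction.
    If [g] is minimal, expanding [g_n] gives [<g_n, f_n> = 1] and hence
    [||f_n|| ||g_n|| >= 1]. Finally, two Bessel sequences have bounded mixed
    sums, so dual frames reconstruct unconditionally. *)

Require Import Defs.
From HB Require Import structures.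
From mathcomp Require Import all_boot all_order all_algebra.
From mathcomp Require Import complex.
From mathcomp Require Import all_classical all_reals all_analysis.
From mathcomp Require Import ring lra.

Set Implicit Arguments.
Unset Strict Implicit.
Unset Printing Implicit Defensive.

Import Order.TTheory GRing.Theory Num.Theory.
Import numFieldNormedType.Exports.

Local Open Scope classical_set_scope.
Local Open Scope ring_scope.

(** * Real and complex scalars *)

Definition scalar_of_real (R : realType) (k : scalar_kind) :
    R -> scalar_field R k :=
  match k with RealScalars => idfun | ComplexScalars => @real_complex R end.

Section Scalars.
Variables (R : realType) (k : scalar_kind).
Local Notation K := (scalar_field R k).
Implicit Types (x y : K) (r : R).

Local Notation "r %:S" := (@scalar_of_real R k r) (at level 2, format "r %:S").

Lemma scalar_reD x y : scalar_re (x + y) = scalar_re x + scalar_re y.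
Proof. by case: k x y => [] // [a b] [c d]. Qed.

Lemma scalar_reN x : scalar_re (- x) = - scalar_re x.
Proof. by case: k x => [] // [a b]. Qed.

Lemma scalar_re0 : scalar_re (0 : K) = 0.
Proof. by case: k. Qed.

Lemma scalar_re1 : scalar_re (1 : K) = 1.
Proof. by case: k. Qed.

Lemma scalar_re_conj x : scalar_re (scalar_conj x) = scalar_re x.
Proof. by case: k x => [] // [a b]. Qed.

Lemma scalar_conjM x y : scalar_conj (x * y) = scalar_conj x * scalar_conj y.
Proof. by case: k x y => [] // x y; exact: rmorphM. Qed.

Lemma scalar_conjK x : scalar_conj (scalar_conj x) = x.
Proof. by case: k x => [] // x; exact: conjcK. Qed.

Lemma scalar_mul_conj x : x * scalar_conj x = `|x| ^+ 2.
Proof.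
case: k x => [] x /=; first by rewrite real_normK ?num_real // expr2.
by rewrite sqr_normc.
Qed.

Lemma scalar_conj_norm (V : normedZmodType K) (v : V) :
  scalar_conj `|v| = `|v|.
Proof.
have : 0 <= `|v| by [].
case: k V v => [] V v //=; case: `|v| => a b /=.
by rewrite lecE /= => /andP[/eqP -> _]; rewrite oppr0.
Qed.

Lemma scalar_of_realE r : scalar_re r%:S = r.
Proof. by case: k. Qed.

Lemma scalar_of_real_re x : 0 <= x -> (scalar_re x)%:S = x.
Proof.
case: k x => [] //= [a b].
by rewrite lecE /= => /andP[/eqP -> _].
Qed.

Lemma scalar_le r1 r2 : (r1%:S <= r2%:S) = (r1 <= r2).
Proof. by case: k => //=; rewrite lecR. Qed.

Lemma scalar_lt r1 r2 : (r1%:S < r2%:S) = (r1 < r2).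
Proof. by case: k => //=; rewrite ltcR. Qed.

Lemma scalar_of_real0 : 0%:S = 0.
Proof. by case: k. Qed.

Lemma scalar_of_realD r1 r2 : (r1 + r2)%:S = r1%:S + r2%:S.
Proof. by case: k => //=; rewrite rmorphD. Qed.

Lemma scalar_of_realM r1 r2 : (r1 * r2)%:S = r1%:S * r2%:S.
Proof. by case: k => //=; rewrite rmorphM. Qed.

Lemma scalar_re_abs x : `|scalar_re x| <= rnorm x.
Proof.
rewrite /rnorm -scalar_le scalar_of_real_re //.
by case: k x => [] //= x; exact: normc_ge_Re.
Qed.

Lemma scalar_re_norm_sqr (V : normedZmodType K) (v : V) :
  scalar_re (`|v| ^+ 2) = rnorm v ^+ 2.
Proof.
by rewrite -[`|v|]scalar_of_real_re// !expr2 -scalar_of_realM scalar_of_realE.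
Qed.

Variable V : normedZmodType K.
Implicit Types v w : V.

Lemma rnormE v : (rnorm v)%:S = `|v|.
Proof. exact: scalar_of_real_re. Qed.

Lemma rnorm_ge0 v : 0 <= rnorm v.
Proof. by rewrite -scalar_le rnormE scalar_of_real0. Qed.

Lemma rnormD v w : rnorm (v + w) <= rnorm v + rnorm w.
Proof. by rewrite -scalar_le scalar_of_realD !rnormE ler_normD. Qed.

Lemma rnormN v : rnorm (- v) = rnorm v.
Proof. by rewrite /rnorm normrN. Qed.

Lemma rnormB v w : rnorm (v - w) = rnorm (w - v).
Proof. by rewrite -rnormN opprB. Qed.

Lemma rnorm0 : rnorm (0 : V) = 0.
Proof. by rewrite /rnorm normr0 scalar_re0. Qed.

Lemma rnorm_eq0 v : (rnorm v == 0) = (v == 0).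
Proof.
apply/eqP/eqP => [v0|->]; last exact: rnorm0.
by apply/eqP; rewrite -normr_eq0 -rnormE v0 scalar_of_real0.
Qed.

Lemma rnorm_gt0 v : (0 < rnorm v) = (v != 0).
Proof. by rewrite lt_neqAle eq_sym rnorm_eq0 rnorm_ge0 andbT. Qed.

Lemma rnorm_sum (I : Type) (s : seq I) (P : pred I) (F : I -> V) :
  rnorm (\sum_(i <- s | P i) F i) <= \sum_(i <- s | P i) rnorm (F i).
Proof.
elim/big_ind2: _ => [|a b c d ab cd|//]; first by rewrite rnorm0.
by rewrite (le_trans (rnormD _ _))// lerD.
Qed.

End Scalars.
Notation "r %:S" := (scalar_of_real _ r) (at level 2, format "r %:S").

Section NormedModules.
Variables (R : realType) (k : scalar_kind).
Local Notation K := (scalar_field R k).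
Variable V : normedModType K.
Implicit Types (c : K) (v w : V).

Lemma rnormZ c v : rnorm (c *: v) = rnorm c * rnorm v.
Proof.
by rewrite -[LHS](scalar_of_realE k) rnormE normrZ -!rnormE -scalar_of_realM
  scalar_of_realE.
Qed.

Lemma rnormM (a b : K) : rnorm (a * b) = rnorm a * rnorm b.
Proof.
by rewrite -[LHS](scalar_of_realE k) rnormE normrM -!rnormE -scalar_of_realM
  scalar_of_realE.
Qed.

Lemma rnorm_real (r : R) : 0 <= r -> rnorm (r%:S : K) = r.
Proof.
by move=> r0; rewrite /rnorm ger0_norm ?scalar_of_realE //
  -(scalar_of_real0 _ k) scalar_le.
Qed.

Lemma rnorm_norm v : rnorm (`|v| : K) = rnorm v.
Proof. by rewrite /rnorm normr_id. Qed.

Lemma rnormV c : rnorm c^-1 = (rnorm c)^-1.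
Proof.
have [->|c0] := eqVneq c 0; first by rewrite invr0 rnorm0 invr0.
apply: (@mulfI _ (rnorm c)); first by rewrite rnorm_eq0.
rewrite -rnormM !divff ?rnorm_eq0 //.
by rewrite /rnorm normr1 scalar_re1.
Qed.

Lemma rnorm_conj c : rnorm (scalar_conj c) = rnorm c.
Proof.
apply/eqP; rewrite -(eqrXn2 (n := 2)) ?rnorm_ge0//.
by rewrite -!scalar_re_norm_sqr -!scalar_mul_conj scalar_conjK mulrC.
Qed.

(** A positive element of [K] is the image of a positive real, so real tolerances suffice for both
    kinds of scalars. *)
Lemma rcvgP (u : nat -> V) (l : V) : u @ \oo --> l <->
  forall e : R, 0 < e -> exists N : nat, forall n, (N <= n)%N ->
    rnorm (l - u n) < e.
Proof.
split=> [/cvgrPdist_lt ul e e0|ul].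
  have /ul[N _ NP] : 0 < e%:S :> K by rewrite -(scalar_of_real0 _ k) scalar_lt.
  by exists N => n Nn; rewrite -(scalar_lt k) rnormE; exact: NP.
apply/cvgrPdist_lt => e e0.
have /ul[N NP] : 0 < scalar_re e.
  by rewrite -(scalar_lt k) scalar_of_real0 scalar_of_real_re // ltW.
exists N => // n /= /NP; rewrite -(scalar_lt k) rnormE scalar_of_real_re //.
exact: ltW.
Qed.

Lemma rcvg_cauchy (u : nat -> V) : cvgn u -> forall e : R, 0 < e ->
  exists N : nat, forall m n, (N <= m)%N -> (N <= n)%N -> rnorm (u m - u n) < e.
Proof.
case/cvg_ex => l /rcvgP ul e e0.
have [N NP] := ul (e / 2) ltac:(by rewrite divr_gt0).
exists N => m n /NP um /NP un.
have -> : u m - u n = (l - u n) - (l - u m) by rewrite opprB [RHS]addrC addrA subrK.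
by rewrite (le_lt_trans (rnormD _ _)) // rnormN (splitr e) ltrD.
Qed.

End NormedModules.

Lemma rcauchy_cvg (R : realType) (k : scalar_kind)
    (V : completeNormedModType (scalar_field R k)) (u : nat -> V) :
  (forall e : R, 0 < e -> exists N : nat, forall n, (N <= n)%N ->
     rnorm (u N - u n) < e) -> cvgn u.
Proof.
move=> uC; apply: cauchy_cvg; apply: cauchy_exP => e e0.
have /uC[N NP] : 0 < scalar_re e.
  by rewrite -(scalar_lt k) scalar_of_real0 scalar_of_real_re // ltW.
exists (u N), N => // n /= /NP; rewrite -ball_normE /=.
by rewrite -(scalar_lt k) rnormE scalar_of_real_re // ltW.
Qed.

(** * Rearrangements and bounded finite sums *)

Definition bounded_sums (R : realType) (k : scalar_kind)
    (V : normedZmodType (scalar_field R k)) (u : nat -> V) (C : R) :=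
  forall s : seq nat, uniq s -> rnorm (\sum_(n <- s) u n) <= C.

Section Rearrangements.
Variables (R : realType) (k : scalar_kind) (V : normedModType (scalar_field R k)).
Implicit Types (u : nat -> V) (L t s : seq nat).

(** A finite sum exceeding the total norm over [L] by more than [1] stays above [1] once its indices
    in [L] are dropped. The remaining indices [P] come first in the new block; [Q] then fills the
    gaps, so that an initial segment of the integers is again enumerated. *)
Lemma unbounded_sums_extension u L : (forall C : R, ~ bounded_sums u C) ->
  perm_eq L (iota 0 (size L)) -> exists ti : seq nat * nat,
    [/\ (0 < size ti.1)%N, (ti.2 <= size ti.1)%N,
        perm_eq (L ++ ti.1) (iota 0 (size (L ++ ti.1))) &
        1 <= rnorm (\sum_(n <- take ti.2 ti.1) u n)].
Proof.
move=> ub Lperm.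
have Luniq : uniq L by rewrite (perm_uniq Lperm) iota_uniq.
have memL n : (n \in L) = (n < size L)%N.
  by rewrite (perm_mem Lperm) mem_iota.
have /existsNP[s /not_implyP[suniq /negP]] :=
  ub (\sum_(n <- L) rnorm (u n) + 1).
rewrite -ltNge => sbig.
pose P := [seq n <- s | n \notin L].
have Pbig : 1 <= rnorm (\sum_(n <- P) u n).
  move: sbig; rewrite [X in rnorm X](bigID (mem L)) /=.
  rewrite -[X in rnorm (X + _)]big_filter -[X in rnorm (_ + X)]big_filter.
  move=> /lt_le_trans/(_ (rnormD _ _)).
  have : rnorm (\sum_(i <- [seq i <- s | i \in L]) u i) <=
      \sum_(n <- L) rnorm (u n).
    rewrite (le_trans (rnorm_sum _ _ _))//.
    rewrite (perm_big [seq i <- L | i \in s]); last first.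
      apply: uniq_perm; rewrite ?filter_uniq// => x.
      by rewrite !mem_filter andbC.
    by rewrite big_filter big_mkcond/= ler_sum// => i _; case: ifP => // _;
      exact: rnorm_ge0.
  lra.
(* [M] exceeds every index in [L], all of which are below [size L], and every index in [P]. *)
pose M := (size L + \sum_(n <- P) n.+1)%N.
pose Q := [seq n <- iota 0 M | n \notin L ++ P].
have LPQ : perm_eq (L ++ (P ++ Q)) (iota 0 M).
  apply: uniq_perm; rewrite ?iota_uniq //.
    rewrite catA cat_uniq filter_uniq ?iota_uniq// andbT cat_uniq Luniq.
    rewrite filter_uniq//= andbT; apply/andP; split; apply/hasPn => x.
      by rewrite mem_filter => /andP[].
    by rewrite mem_filter => /andP[].
  move=> x; rewrite catA mem_cat [in X in _ || X]mem_filter mem_iota /= add0n.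
  case: (boolP (x \in L ++ P)) => //=; rewrite mem_cat => /orP[xL|xP].
    by rewrite /M ltn_addr// -memL.
  by rewrite /M ltn_addl// (big_rem x)//= ltn_addr.
have sz : size (L ++ (P ++ Q)) = M by rewrite (perm_size LPQ) size_iota.
exists (P ++ Q, size P); split => /=.
- rewrite size_cat ltn_addr// lt0n size_eq0; apply: contraTneq Pbig => ->.
  by rewrite big_nil rnorm0 lt_geF.
- by rewrite size_cat leq_addr.
- by rewrite sz.
- by rewrite take_size_cat.
Qed.

(* Finite blocks whose sums have norm at least [1] are prefixed to larger and
   larger initial segments, so that the resulting rearrangement is not Cauchy. *)
Lemma rearrangements_bounded_sums u :
  (forall s : nat -> nat, bijective s -> cvgn (series (u \o s))) ->
  exists C : R, bounded_sums u C.
Proof.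
move=> ucvg; apply: contrapT => /forallNP ub.
have /choice[ext extP] : forall L, exists ti : seq nat * nat,
    perm_eq L (iota 0 (size L)) ->
    [/\ (0 < size ti.1)%N, (ti.2 <= size ti.1)%N,
        perm_eq (L ++ ti.1) (iota 0 (size (L ++ ti.1))) &
        1 <= rnorm (\sum_(n <- take ti.2 ti.1) u n)].
  move=> L; case: (boolP (perm_eq L (iota 0 (size L)))) => [pL|_].
    by have [ti tiP] := unbounded_sums_extension ub pL; exists ti.
  (* Default value for lists that do not enumerate an initial segment; by [Lperm] the iterates never
     meet it. *)
  by exists ([::], 0%N).
pose L m := iter m (fun l => l ++ (ext l).1) [::].
have Lperm m : perm_eq (L m) (iota 0 (size (L m))).
  by elim: m => //= m /extP[].
have LS m : L m.+1 = L m ++ (ext (L m)).1 by [].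
have Lsize m : (m <= size (L m))%N.
  elim: m => // m IH; rewrite LS size_cat.
  by have [e0 _ _ _] := extP _ (Lperm m); rewrite -addn1 leq_add.
have Lprefix m d : exists t, L (m + d)%N = L m ++ t.
  elim: d => [|d [t Ht]]; first by exists [::]; rewrite addn0 cats0.
  by exists (t ++ (ext (L (m + d)%N)).1); rewrite addnS LS Ht catA.
have Lnth m n j : (m <= n)%N -> (j < size (L m))%N ->
    nth 0%N (L n) j = nth 0%N (L m) j.
  by move=> /subnKC <- jm; have [t ->] := Lprefix m (n - m)%N; rewrite nth_cat jm.
(* [L n.+1] has more than [n] entries, and longer stages keep them, so [s] is the common limit of
   the lists. *)
pose s n := nth 0%N (L n.+1) n.
have sE m j : (j < size (L m))%N -> s j = nth 0%N (L m) j.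
  move=> jm; rewrite /s -(Lnth m (maxn m j.+1)) ?leq_maxl//.
  by rewrite -(Lnth j.+1 (maxn m j.+1)) ?leq_maxr.
have sbij : bijective s.
  rewrite -setTT_bijective; split=> //.
  - move=> i j _ _.
    have iL : (i < size (L (maxn i j).+1))%N.
      by rewrite (leq_trans _ (Lsize _))// ltnS leq_maxl.
    have jL : (j < size (L (maxn i j).+1))%N.
      by rewrite (leq_trans _ (Lsize _))// ltnS leq_maxr.
    rewrite (sE _ _ iL) (sE _ _ jL) => /eqP.
    by rewrite nth_uniq ?(perm_uniq (Lperm _)) ?iota_uniq// => /eqP.
  - move=> n _; have nL : n \in L n.+1.
      by rewrite (perm_mem (Lperm _)) mem_iota /= add0n.
    by exists (index n (L n.+1)) => //; rewrite (sE n.+1) ?index_mem// nth_index.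
have [N NP] := rcvg_cauchy (ucvg s sbij) ltr01.
have [_ iP _ big] := extP _ (Lperm N).
set t := (ext (L N)).1 in iP big; set i := (ext (L N)).2 in iP big.
(* Between these two positions [s] runs through exactly the large prefix of the block appended to
   [L N]. *)
have := NP (size (L N) + i)%N (size (L N)) (leq_trans (Lsize N) (leq_addr _ _)) (Lsize N).
apply/negP; rewrite -leNgt.
suff -> : series (u \o s) (size (L N) + i)%N - series (u \o s) (size (L N)) =
    \sum_(n <- take i t) u n by [].
rewrite /series /= (big_cat_nat (n := size (L N)))//= ?leq_addr// addrAC subrr add0r.
have ti : size (take i t) = i by rewrite size_takel.
rewrite [RHS](big_nth 0%N) ti -{1}[size (L N)]add0n [(size _ + i)%N]addnC big_addn addnK.
apply: eq_big_nat => j /= ji.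
rewrite (sE N.+1) LS ?nth_cat.
  by rewrite ltnNge leq_addl/= addnK nth_take.
by rewrite size_cat addnC ltn_add2l (leq_trans ji).
Qed.

End Rearrangements.

(** * Uniform boundedness *)

Section UniformBoundedness.
Variables (R : realType) (k : scalar_kind).
Local Notation K := (scalar_field R k).
Variables (H : completeNormedModType K) (T : Type) (p : T -> H -> R).
Hypothesis pD : forall t x y, p t (x + y) <= p t x + p t y.
Hypothesis pZ : forall t (a : K) x, p t (a *: x) = rnorm a * p t x.
Hypothesis p_bounded : forall t, exists M : R, forall x, p t x <= M * rnorm x.

Let pN t x : p t (- x) = p t x.
Proof. by rewrite -scaleN1r pZ rnormN /rnorm normr1 scalar_re1 mul1r. Qed.

(** Some [h] of norm [r / 2] has [p t h] above [n + 1]. Since [2 * p t h] is at most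
    [p t (y + h) + p t (y - h)], one of [y + h] and [y - h] is a suitable new centre, and continuity
    of [p t] supplies the ball. *)
Lemma unbounded_on_ball (n : nat) (y : H) (r : R) : 0 < r ->
  (forall C : R, ~ forall t x, p t x <= C * rnorm x) ->
  exists yrt : H * R * T,
    [/\ 0 < yrt.1.2, yrt.1.2 <= r / 2, rnorm (yrt.1.1 - y) <= r / 2 &
        forall z, rnorm (yrt.1.1 - z) <= yrt.1.2 -> n%:R <= p yrt.2 z].
Proof.
(* Chosen so that a vector of norm [r / 2] violating the bound [C] has seminorm above [n + 1]. *)
move=> r0 ub; pose C : R := (n%:R + 1) / (r / 2).
have /existsNP[t /existsNP[x /negP]] := ub C.
rewrite -ltNge => Cx.
have x0 : x != 0.
  apply: contraTneq Cx => ->; rewrite rnorm0 mulr0 -(scale0r (0 : H)) pZ.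
  by rewrite rnorm0 mul0r ltxx.
have nx0 : 0 < rnorm x by rewrite rnorm_gt0.
pose a : R := r / 2 / rnorm x.
have a0 : 0 < a by rewrite !divr_gt0.
pose h := (a%:S : K) *: x.
have rh : rnorm h = r / 2.
  by rewrite rnormZ rnorm_real ?ltW// divfK// gt_eqF.
have ph : n%:R + 1 < p t h.
  rewrite pZ rnorm_real ?ltW// mulrC -ltr_pdivrMr//.
  suff -> : (n%:R + 1) / a = C * rnorm x by [].
  by rewrite /C /a invf_div mulrA mulrAC.
have [y' [y'y py']] : exists y', rnorm (y' - y) = r / 2 /\ n%:R + 1 < p t y'.
  have p2 : 2 * p t h <= p t (y + h) + p t (y - h).
    rewrite -(pN _ (y - h)) (le_trans _ (pD _ _ _))//.
    rewrite opprB addrC subrKA.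
    have -> : h + h = (2 : R)%:S *: h.
      by rewrite scalar_of_realD scalerDl (_ : 1%:S = 1) ?scale1r//; case: (k).
    by rewrite pZ rnorm_real.
  have [|yh] := ltP (n%:R + 1) (p t (y + h)).
    by exists (y + h); rewrite addrC addKr.
  exists (y - h); split; last by lra.
  by rewrite addrC addKr rnormN.
have [M Mp] := p_bounded t.
have M0 : 0 < `|M| + 1 by rewrite ltr_wpDl.
(* Within distance [(|M| + 1)^-1] of [y'] the seminorm [p t] drops by at most [1]; the added [1]
   keeps the inverse positive. *)
exists (y', Num.min (r / 2) (`|M| + 1)^-1, t) => /=; split.
- by rewrite lt_min divr_gt0//= invr_gt0.
- by rewrite ge_min lexx.
- by rewrite y'y.
move=> z; rewrite le_min => /andP[_ zy'].
have : p t y' <= p t z + 1.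
  rewrite -(subrKC z y') (le_trans (pD _ _ _))// lerD2l (le_trans (Mp _))//.
  rewrite (@le_trans _ _ ((`|M| + 1) * rnorm (y' - z)))//.
    by rewrite ler_wpM2r ?rnorm_ge0// (le_trans (ler_norm _))// lerDl.
  by rewrite mulrC -ler_pdivlMr// div1r.
lra.
Qed.

(** Instead of Baire's theorem, nested balls with at least halved radii are built, the [n]-th step
    forcing some [p t] to be at least [n] on the new ball. The limit of the centres lies in all of
    them and contradicts the pointwise bound. *)
Lemma uniform_boundedness :
  (forall x, exists M : R, forall t, p t x <= M) ->
  exists C : R, forall t x, p t x <= C * rnorm x.
Proof.
move=> ptw; apply: contrapT => /forallNP ub.
have /choice[step stepP] : forall nyr : nat * (H * R), exists yrt : H * R * T,
    0 < nyr.2.2 ->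
    [/\ 0 < yrt.1.2, yrt.1.2 <= nyr.2.2 / 2,
        rnorm (yrt.1.1 - nyr.2.1) <= nyr.2.2 / 2 &
        forall z, rnorm (yrt.1.1 - z) <= yrt.1.2 -> nyr.1%:R <= p yrt.2 z].
  move=> [n [y r]]; case: (ltP 0 r) => r0.
    by have [yrt yrtP] := unbounded_on_ball n y r0 ub; exists yrt.
  (* For a nonpositive radius any value will do; failure of the bound [0] shows that [T] is
     inhabited. *)
  have /existsNP[t _] := ub 0.
  by exists (0, 0, t).
pose fix st n : H * R :=
  if n is m.+1 then (step (m, st m)).1 else (0, 1).
pose y n := (st n).1; pose r n := (st n).2.
have r_gt0 n : 0 < r n.
  by elim: n => [|n IH]; [exact: ltr01|have [] := stepP (n, st n) IH].
have rS n : r n.+1 <= r n / 2 by have [] := stepP (n, st n) (r_gt0 n).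
have yS n : rnorm (y n.+1 - y n) <= r n / 2.
  by have [] := stepP (n, st n) (r_gt0 n).
have ball n z : rnorm (y n.+1 - z) <= r n.+1 -> n%:R <= p (step (n, st n)).2 z.
  by have [_ _ _] := stepP (n, st n) (r_gt0 n); exact.
have r_small n : r n <= 2^-1 ^+ n.
  elim: n => [|n IH]; first by rewrite expr0.
  by rewrite (le_trans (rS n))// exprSr ler_wpM2r// invr_ge0.
(* Ball inclusion in a form that survives induction: a step moves the centre by at most half the
   radius and keeps at most half of it. *)
have nested n d : rnorm (y n - y (n + d)%N) + r (n + d)%N <= r n.
  elim: d => [|d IH]; first by rewrite addn0 subrr rnorm0 add0r.
  have := rS (n + d)%N; have := yS (n + d)%N; rewrite addnS.
  have : rnorm (y n - y (n + d).+1) <= rnorm (y n - y (n + d)%N) +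
      rnorm (y (n + d).+1 - y (n + d)%N).
    by rewrite (rnormB (y (n + d).+1)) -{1}(subrK (y (n + d)%N) (y n)) -addrA rnormD.
  by have := r_gt0 (n + d)%N; lra.
have near_y n m : (n <= m)%N -> rnorm (y n - y m) <= r n.
  move=> /subnKC <-; have := nested n (m - n)%N.
  by have := r_gt0 (n + (m - n))%N; lra.
have /cvg_ex[l /rcvgP yl] : cvgn y.
  apply: rcauchy_cvg => e e0.
  have [N _ /(_ N (leqnn N)) NP] : \forall n \near \oo, 2^-1 ^+ n < e.
    have /cvgrPdist_lt/(_ e e0) : (fun n => 2^-1 ^+ n : R) @ \oo --> (0 : R).
      apply: cvg_expr; rewrite ger0_norm// invf_lt1//; lra.
    by apply: filterS => n; rewrite sub0r normrN ger0_norm// exprn_ge0.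
  by exists N => n Nn; rewrite (le_lt_trans (near_y _ _ Nn))// (le_lt_trans (r_small N)).
have yl_r n : rnorm (y n - l) <= r n.
  apply/ler_addgt0Pr => e e0; have [N NP] := yl e e0.
  have := NP (maxn n N) (leq_maxr _ _).
  have := near_y _ _ (leq_maxl n N).
  have := rnormD (y n - y (maxn n N)) (y (maxn n N) - l).
  by rewrite subrKA (rnormB (y (maxn n N)) l); lra.
have [M MP] := ptw l.
have := ball (Num.truncn M).+1 l (yl_r _).
by rewrite leNgt (le_lt_trans (MP _))// truncnS_gt.
Qed.

End UniformBoundedness.

(** * Inner products *)

Section InnerProduct.
Variables (R : realType) (k : scalar_kind).
Local Notation K := (scalar_field R k).
Variables (H : normedModType K) (dot : {dot H for @scalar_conj R k}).
Hypothesis dot_norm : induces_norm dot.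
Implicit Types (x y z : H) (a : K).

(** A real inner product with the same norm, which treats both kinds of scalars at once. *)
Definition rdot x y : R := scalar_re (dot x y).

Lemma dotDl x y z : dot (x + y) z = dot x z + dot y z.
Proof. exact: linearDl. Qed.

Lemma dotZl a x y : dot (a *: x) y = a * dot x y.
Proof. exact: linearZl_LR. Qed.

Lemma dotC x y : dot x y = scalar_conj (dot y x).
Proof. by rewrite (@hermitian_subproof _ _ _ _ dot) expr0 mul1r. Qed.

Lemma dotZr a x y : dot x (a *: y) = scalar_conj a * dot x y.
Proof. by rewrite dotC dotZl scalar_conjM -dotC. Qed.

Lemma rdotC x y : rdot x y = rdot y x.
Proof. by rewrite /rdot dotC scalar_re_conj. Qed.

Lemma rdotDl x y z : rdot (x + y) z = rdot x z + rdot y z.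
Proof. by rewrite /rdot dotDl scalar_reD. Qed.

Lemma rdotDr x y z : rdot x (y + z) = rdot x y + rdot x z.
Proof. by rewrite rdotC rdotDl !(rdotC x). Qed.

Lemma rdotNl x y : rdot (- x) y = - rdot x y.
Proof. by rewrite /rdot -scaleN1r dotZl mulN1r scalar_reN. Qed.

Lemma rdotNr x y : rdot x (- y) = - rdot x y.
Proof. by rewrite rdotC rdotNl rdotC. Qed.

Lemma rdot0l y : rdot 0 y = 0.
Proof. by rewrite /rdot -(scale0r (0 : H)) dotZl mul0r scalar_re0. Qed.

Lemma rdotZl (r : R) x y : rdot (r%:S *: x) y = r * rdot x y.
Proof.
rewrite /rdot dotZl; case: (k) (dot x y) => [] //= [b c].
by rewrite /= mul0r subr0.
Qed.

Lemma rdot_suml (s : seq nat) (u : nat -> H) y :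
  rdot (\sum_(n <- s) u n) y = \sum_(n <- s) rdot (u n) y.
Proof.
by elim/big_rec2: _ => [|n a b _ <-]; rewrite ?rdot0l ?rdotDl.
Qed.

Lemma rdotxx x : rdot x x = rnorm x ^+ 2.
Proof.
by rewrite /rdot -dot_norm scalar_re_norm_sqr.
Qed.

Lemma rdot_cauchy_schwarz x y : `|rdot x y| <= rnorm x * rnorm y.
Proof.
have [->|y0] := eqVneq y 0.
  by rewrite rdotC rdot0l normr0 mulr_ge0 ?rnorm_ge0.
have ny : 0 < rnorm y ^+ 2 by rewrite exprn_gt0// rnorm_gt0.
(* The coefficient of the projection of [x] on [y], which minimizes the norm of [x - t y]. *)
pose t := rdot x y / rnorm y ^+ 2.
have : 0 <= rdot (x - t%:S *: y) (x - t%:S *: y).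
  by rewrite rdotxx exprn_ge0// rnorm_ge0.
rewrite rdotDl !rdotDr !rdotNl !rdotNr !rdotZl !(rdotC _ (_ *: y)) !rdotZl.
rewrite !rdotxx (rdotC y x) opprK.
have -> : t * (t * rnorm y ^+ 2) = t * rdot x y by rewrite /t divfK// gt_eqF.
rewrite addNr addr0 subr_ge0 /t mulrAC ler_pdivrMr// -expr2 -exprMn => le2.
by rewrite -(ler_pXn2r (n := 2)) ?nnegrE ?mulr_ge0 ?rnorm_ge0// real_normK ?num_real.
Qed.

(** Multiplying [x] by the conjugate of [dot x y] makes the product real, which reduces the claim to
    [rdot]. *)
Lemma dot_cauchy_schwarz x y : rnorm (dot x y) <= rnorm x * rnorm y.
Proof.
have [->|d0] := eqVneq (dot x y) 0.
  by rewrite rnorm0 mulr_ge0 ?rnorm_ge0.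
have nd : 0 < rnorm (dot x y) by rewrite rnorm_gt0.
rewrite -(ler_pM2l nd) -expr2.
have dx : rdot (scalar_conj (dot x y) *: x) y = rnorm (dot x y) ^+ 2.
  by rewrite /rdot dotZl mulrC scalar_mul_conj scalar_re_norm_sqr.
rewrite -dx (le_trans (ler_norm _))// (le_trans (rdot_cauchy_schwarz _ _))//.
by rewrite rnormZ mulrA rnorm_conj.
Qed.

Lemma parallelogram x y :
  rnorm (x + y) ^+ 2 + rnorm (x - y) ^+ 2 = 2 * (rnorm x ^+ 2 + rnorm y ^+ 2).
Proof.
rewrite -!rdotxx !rdotDl !rdotDr !rdotNl !rdotNr; ring.
Qed.

Lemma rdot_inj x y : (forall z, rdot x z = rdot y z) -> x = y.
Proof.
move=> xy; apply/eqP; rewrite -subr_eq0 -rnorm_eq0 -sqrf_eq0 -rdotxx.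
by rewrite rdotDl rdotNl xy subrr.
Qed.

Lemma rdot_cvg (u : nat -> H) x y :
  u @ \oo --> x -> (fun n => rdot (u n) y) @ \oo --> rdot x y.
Proof.
move=> /rcvgP ux; apply/cvgrPdist_lt => e e0.
have y0 : 0 < rnorm y + 1 by rewrite ltr_wpDl ?rnorm_ge0.
have /ux[N NP] : 0 < e / (rnorm y + 1) by rewrite divr_gt0.
exists N => // n /= /NP; rewrite ltr_pdivlMr// => lte.
rewrite -rdotNl -rdotDl (le_lt_trans (rdot_cauchy_schwarz _ _))//.
by rewrite (le_lt_trans _ lte)// ler_wpM2l ?rnorm_ge0// lerDl.
Qed.

(* By the parallelogram law one of [x + y] and [x - y] has squared norm at least
   [rnorm x ^+ 2 + rnorm y ^+ 2]; the blocks can thus be signed one by one. *)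
Lemma signed_blocks (u : nat -> H) (ss : seq (seq nat)) :
  exists P Q, perm_eq (P ++ Q) (flatten ss) /\
    \sum_(s <- ss) rnorm (\sum_(n <- s) u n) ^+ 2 <=
      rnorm (\sum_(n <- P) u n - \sum_(n <- Q) u n) ^+ 2.
Proof.
elim: ss => [|s ss [P [Q [PQ IH]]]].
  by exists [::], [::]; rewrite !big_nil subr0 rnorm0 expr0n.
rewrite big_cons /=; set X := \sum_(n <- P) u n - _ in IH.
have := parallelogram X (\sum_(n <- s) u n).
have [le_add pl|lt_add pl] := leP (rnorm (\sum_(n <- s) u n) ^+ 2 + rnorm X ^+ 2)
    (rnorm (X + \sum_(n <- s) u n) ^+ 2).
  exists (s ++ P), Q; rewrite -catA perm_cat2l; split=> //.
  by rewrite big_cat /= -addrA addrC; lra.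
exists P, (s ++ Q); split; first by rewrite perm_catCA perm_cat2l.
by rewrite big_cat /= opprD addrCA addrC; lra.
Qed.

(** The signed sum is a difference of two finite sums without repeated indices, each of norm at most
    [C]. *)
Lemma bounded_sums_blocks (u : nat -> H) (C : R) (ss : seq (seq nat)) :
  bounded_sums u C -> uniq (flatten ss) ->
  \sum_(s <- ss) rnorm (\sum_(n <- s) u n) ^+ 2 <= (2 * C) ^+ 2.
Proof.
move=> uC; have [P [Q [PQ le_PQ]]] := signed_blocks u ss.
rewrite -(perm_uniq PQ) cat_uniq => /and3P[Pu _ Qu].
have := uC _ Pu; have := uC _ Qu => leQ leP.
have C0 : 0 <= C := le_trans (rnorm_ge0 _) leP.
rewrite (le_trans le_PQ)// lerXn2r ?nnegrE ?rnorm_ge0 ?mulr_ge0//.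
by rewrite (le_trans (rnormD _ _))// rnormN; lra.
Qed.

Lemma bounded_sums_sqr (u : nat -> H) (C : R) (s : seq nat) :
  bounded_sums u C -> uniq s ->
  \sum_(n <- s) rnorm (u n) ^+ 2 <= (2 * C) ^+ 2.
Proof.
move=> uC su; have := bounded_sums_blocks (ss := [seq [:: n] | n <- s]) uC.
rewrite flatten_map1 map_id big_map => /(_ su).
by under eq_bigr do rewrite big_seq1.
Qed.

End InnerProduct.

(** * Convergence from bounded finite sums *)

Section BoundedSumsConvergence.
Variables (R : realType) (k : scalar_kind).
Variables (H : completeNormedModType (scalar_field R k)).
Variables (dot : {dot H for @scalar_conj R k}).
Hypothesis dot_norm : induces_norm dot.

Lemma bounded_sums_cvg (u : nat -> H) (C : R) :
  bounded_sums u C -> cvgn (series u).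
Proof.
move=> uC; apply: rcauchy_cvg => e e0; apply: contrapT => /forallNP gap.
(* If the series is not Cauchy at [e], a block of norm at least [e] starts at any index. [M] bounds
   the indices used so far, so a block starting there is disjoint from the earlier ones. *)
have blocks m : exists (ss : seq (seq nat)) (M : nat),
    [/\ uniq (flatten ss), all (ltn^~ M) (flatten ss) &
        m%:R * e ^+ 2 <= \sum_(s <- ss) rnorm (\sum_(n <- s) u n) ^+ 2].
  elim: m => [|m [ss [M [ssu ssM le_ss]]]].
    by exists [::], 0%N; rewrite big_nil mul0r.
  have /existsNP[n /not_implyP[Mn /negP]] := gap M.
  rewrite -leNgt => big.
  exists (iota M (n - M) :: ss), n; split => /=.
  - rewrite cat_uniq iota_uniq ssu /= andbT; apply/hasPn => x /(allP ssM) /= xM.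
    by rewrite mem_iota negb_and -ltnNge xM.
  - rewrite all_cat; apply/andP; split; apply/allP => x.
      by rewrite mem_iota subnKC// => /andP[].
    by move=> /(allP ssM) /= xM; rewrite (leq_trans xM).
  - rewrite big_cons -natr1 mulrDl mul1r addrC lerD//.
    rewrite lerXn2r ?nnegrE ?rnorm_ge0 ?(ltW e0)// (le_trans big)//.
    rewrite rnormB /series /= (big_cat_nat (n := M) (m := 0%N) (p := n))//=.
    by rewrite addrAC subrr add0r.
(* So many blocks that their squared norms add up to more than [(2 * C) ^+ 2]. *)
have [ss [M [ssu _]]] := blocks (Num.truncn ((2 * C) ^+ 2 / e ^+ 2)).+1.
rewrite leNgt => /negP; apply.
rewrite (le_lt_trans (bounded_sums_blocks dot_norm uC ssu))//.
by rewrite -ltr_pdivrMr ?exprn_gt0// truncnS_gt.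
Qed.

Lemma bounded_sums_rearrangement (u : nat -> H) (C : R) (s : nat -> nat) :
  bounded_sums u C -> injective s -> cvgn (series (u \o s)).
Proof.
move=> uC sinj; apply: (@bounded_sums_cvg _ C) => t tu.
by rewrite -(big_map s xpredT u) uC// map_inj_uniq.
Qed.

End BoundedSumsConvergence.

(** * Reconstruction and frames *)

Section Reconstruction.
Variables (R : realType) (k : scalar_kind).
Local Notation K := (scalar_field R k).
Variables (H : completeNormedModType K) (dot : {dot H for @scalar_conj R k}).
Hypothesis dot_norm : induces_norm dot.
Implicit Types (f g h u : nat -> H) (x y z : H) (s : seq nat).

Definition mixed_term f g x (n : nat) : H := dot x (f n) *: g n.

(** The finite sums for [f, g] and for [g, f] are adjoint operators; termwise the two scalars are
    conjugate. *)
Lemma rdot_mixed_swap f g x y s :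
  rdot dot (\sum_(n <- s) mixed_term f g x n) y =
  rdot dot (\sum_(n <- s) mixed_term g f y n) x.
Proof.
rewrite !rdot_suml; apply: eq_bigr => n _.
rewrite /rdot /mixed_term !dotZl -[LHS]scalar_re_conj scalar_conjM -!dotC.
by rewrite mulrC.
Qed.

(** Uniform boundedness is applied to the seminorms indexed by duplicate-free lists. *)
Lemma rearrangements_uniformly_bounded f g :
  (forall x (s : nat -> nat), bijective s -> cvgn (series (mixed_term f g x \o s))) ->
  exists C : R, forall x, bounded_sums (mixed_term f g x) (C * rnorm x).
Proof.
move=> fgcvg.
pose p (t : {s : seq nat | uniq s}) x : R :=
  rnorm (\sum_(n <- sval t) mixed_term f g x n).
have [] := @uniform_boundedness _ _ H _ p.
- move=> t x y; rewrite /p (le_trans _ (rnormD _ _))//.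
  suff -> : \sum_(n <- sval t) mixed_term f g (x + y) n =
    \sum_(n <- sval t) mixed_term f g x n + \sum_(n <- sval t) mixed_term f g y n by [].
  by rewrite -big_split; apply: eq_bigr => n _; rewrite /mixed_term dotDl scalerDl.
- move=> t a x; rewrite /p -rnormZ scaler_sumr; congr rnorm.
  by apply: eq_bigr => n _; rewrite /mixed_term dotZl scalerA.
- move=> t; exists (\sum_(n <- sval t) rnorm (f n) * rnorm (g n)) => x.
  rewrite (le_trans (rnorm_sum _ _ _))// mulr_suml ler_sum// => n _.
  rewrite rnormZ mulrAC ler_wpM2r ?rnorm_ge0// mulrC.
  exact: dot_cauchy_schwarz.
- move=> x; have [C xC] := rearrangements_bounded_sums (fgcvg x).
  by exists C => t; exact: xC (svalP t).
by move=> C pC; exists C => x s su; exact: (pC (exist _ s su) x).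
Qed.

(** Pairing the swapped sum [z] with itself and passing to the adjoint gives
    [‖z‖^2 <= C ‖z‖ ‖x‖]. *)
Lemma bounded_sums_swap f g (C : R) :
  (forall x, bounded_sums (mixed_term f g x) (C * rnorm x)) ->
  forall x, bounded_sums (mixed_term g f x) (C * rnorm x).
Proof.
move=> fgC x s su; set z := \sum_(n <- s) _.
have [->|z0] := eqVneq z 0.
  by have := fgC x [::] isT; rewrite big_nil !rnorm0.
have nz : 0 < rnorm z by rewrite rnorm_gt0.
rewrite -(ler_pM2r nz) -expr2 -(rdotxx dot_norm) /z rdot_mixed_swap -/z.
rewrite (le_trans (ler_norm _))// (le_trans (rdot_cauchy_schwarz dot_norm _ _))//.
by rewrite mulrAC ler_wpM2r ?rnorm_ge0// fgC.
Qed.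

(** The limit is identified weakly: paired with [z], the partial sums equal those of the expansion
    of [z] paired with [x]. *)
Lemma mixed_swap_limit f g x y :
  (forall z, series (mixed_term f g z) @ \oo --> z) ->
  series (mixed_term g f x) @ \oo --> y -> y = x.
Proof.
move=> fg gf; apply: (rdot_inj dot_norm) => z.
have yz := rdot_cvg dot_norm (y := z) gf; have xz := rdot_cvg dot_norm (y := x) (fg z).
rewrite (rdotC dot x); apply: (cvg_unique (@norm_hausdorff _ _) yz).
suff -> : (fun n => rdot dot (series (mixed_term g f x) n) z) =
  fun n => rdot dot (series (mixed_term f g z) n) x by [].
by apply/funext => n; exact: rdot_mixed_swap.
Qed.

Definition reconstructs f g :=
  forall x, unconditionally_sums_to (mixed_term f g x) x.

Lemma reconstructs_bounded f g : reconstructs f g ->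
  exists C : R, forall x, bounded_sums (mixed_term f g x) (C * rnorm x).
Proof.
move=> fg; apply: rearrangements_uniformly_bounded => x s sb.
by have [_] := fg x; exact.
Qed.

Lemma reconstructs_swap f g : reconstructs f g -> reconstructs g f.
Proof.
move=> fg; have [C fgC] := reconstructs_bounded fg.
have gfC := bounded_sums_swap fgC; move=> x; split; last first.
  by move=> s /bij_inj; exact: (bounded_sums_rearrangement dot_norm (gfC x)).
have /cvg_ex[l gfl] := bounded_sums_cvg dot_norm (gfC x).
by rewrite -{2}(@mixed_swap_limit f g x l)// => z; have [] := fg z.
Qed.

(** Moving the [m]-th term of the expansion of [g m] to the left exhibits
    [(1 - dot (g m) (f m)) g m] as a limit of combinations of the other [g n]; a nonzero factor
    would contradict minimality. *)
Lemma minimal_biorthogonal f g m :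
  series (mixed_term f g (g m)) @ \oo --> g m -> minimal_seq g ->
  dot (g m) (f m) = 1.
Proof.
move=> fg /(_ m) gm; apply: contrapT => /eqP fm1; apply: gm.
have c0 : 1 - dot (g m) (f m) != 0 by rewrite subr_eq0 eq_sym.
set c := 1 - _ in c0.
pose u n := c^-1 *: (series (mixed_term f g (g m)) n - mixed_term f g (g m) m).
have ug : u @ \oo --> g m.
  suff e : g m = c^-1 *: (g m - mixed_term f g (g m) m).
    by rewrite [X in _ --> X]e; apply: cvgZr; apply: cvgB => //; exact: cvg_cst.
  by rewrite /mixed_term -{2}(scale1r (g m)) -scalerBl scalerA mulVf// scale1r.
move=> B /ug[N _ NB]; exists (u (maxn N m.+1)).
split; last by apply: NB; rewrite /= leq_maxl.
set M := maxn N m.+1; have mM : (m < M)%N by rewrite /M leq_maxr.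
exists M, (fun i => if i == m :> nat then 0 else c^-1 * dot (g m) (f i)).
(* The span excludes [g m] by index, so position [m] carries the stand-in [g m.+1] with coefficient
   [0]. *)
exists (fun i => if i == m :> nat then g m.+1 else g i); split.
  move=> i; case: eqP => [_|/eqP im]; last by exists (nat_of_ord i).
  by exists m.+1 => //=; rewrite gtn_eqF.
rewrite /u /series /= big_mkord (bigD1 (Ordinal mM))//= addrAC subrr add0r.
rewrite scaler_sumr [RHS](bigD1 (Ordinal mM))//= eqxx scale0r add0r.
by apply: eq_bigr => i; rewrite -val_eqE /= => /negPf ->; rewrite scalerA.
Qed.

(** Termwise [a b <= B a^2 / 2 + b^2 / (2 B)]. With [B] a Bessel bound of [g], the last sum is at
    most [‖z‖^2 / 2] and can be absorbed. *)
Lemma rdot_mixed_le h g x z s (B : R) : 0 < B ->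
  rdot dot (\sum_(n <- s) mixed_term h g x n) z <=
    B / 2 * (\sum_(n <- s) rnorm (dot x (h n)) ^+ 2) +
    B^-1 / 2 * (\sum_(n <- s) rnorm (dot z (g n)) ^+ 2).
Proof.
move=> B0; rewrite rdot_suml !mulr_sumr -big_split ler_sum//= => n _.
rewrite /rdot dotZl (le_trans (ler_norm _))// (le_trans (scalar_re_abs _))//.
rewrite rnormM (dotC dot (g n)) rnorm_conj.
set a := rnorm _; set b := rnorm _.
have : 0 <= B / 2 * (a - B^-1 * b) ^+ 2.
  by rewrite mulr_ge0 ?sqr_ge0// divr_ge0// ltW.
suff -> : B / 2 * (a - B^-1 * b) ^+ 2 = B / 2 * a ^+ 2 + B^-1 / 2 * b ^+ 2 - a * b.
  by rewrite subr_ge0.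
by field; rewrite gt_eqF.
Qed.

(** Finite index sets in any order are used so that the bound serves arbitrary finite sums
    directly. *)
Definition bessel h (B : R) :=
  forall x s, uniq s -> \sum_(n <- s) rnorm (dot x (h n)) ^+ 2 <= B * rnorm x ^+ 2.

Lemma bessel_weaken h (B B' : R) : B <= B' -> bessel h B -> bessel h B'.
Proof.
move=> BB hB x s su; rewrite (le_trans (hB x s su))// ler_wpM2r//.
by rewrite exprn_ge0// rnorm_ge0.
Qed.

Lemma frame_bessel h : frame dot h -> exists2 B : R, 0 < B & bessel h B.
Proof.
move=> [A [B [A0 B0 AB]]]; exists B => // x s su.
pose M := (\sum_(n <- s) n.+1)%N.
have sM : {subset s <= iota 0 M}.
  by move=> n ns; rewrite mem_iota /= add0n /M (big_rem n)//= leq_addr.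
rewrite -lee_fin; have /andP[_] := AB x; apply: le_trans.
rewrite (le_trans _ (nneseries_lim_ge M _))//; last first.
  by move=> n _ _; rewrite lee_fin exprn_ge0// rnorm_ge0.
rewrite sumEFin lee_fin /index_iota subn0.
rewrite (perm_big [seq n <- iota 0 M | n \in s]); last first.
  apply: uniq_perm; rewrite ?filter_uniq ?iota_uniq// => n.
  by rewrite mem_filter andb_idr//; exact: sM.
rewrite big_filter big_mkcond ler_sum// => n _; case: ifP => // _.
by rewrite exprn_ge0// rnorm_ge0.
Qed.

(** For the lower bound, let [S] be the sum of the squared coefficients. Pairing the expansion of
    [x] with [x] gives [‖x‖^2 <= B' S / 2 + ‖x‖^2 / 2], hence the constant [B'^-1]. *)
Lemma bessel_frame h g (B B' : R) : 0 < B -> 0 < B' ->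
  bessel h B -> bessel g B' ->
  (forall x, series (mixed_term h g x) @ \oo --> x) -> frame dot h.
Proof.
move=> B0 B0' hB gB hg; exists B'^-1, B; split; rewrite ?invr_gt0// => x.
have a0 n : (0 <= (rnorm (dot x (h n)) ^+ 2)%:E)%E.
  by rewrite lee_fin exprn_ge0// rnorm_ge0.
have le_B : (\sum_(0 <= n <oo) (rnorm (dot x (h n)) ^+ 2)%:E <=
    (B * rnorm x ^+ 2)%:E)%E.
  apply: lime_le; first exact: is_cvg_nneseries.
  by apply: nearW => n; rewrite sumEFin lee_fin hB// iota_uniq.
rewrite le_B andbT.
have : (0 <= \sum_(0 <= n <oo) (rnorm (dot x (h n)) ^+ 2)%:E)%E.
  exact: nneseries_ge0.
have leS n := @nneseries_lim_ge _ (fun n => (rnorm (dot x (h n)) ^+ 2)%:E)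
  xpredT 0%N n (fun i _ _ => a0 i).
(* The upper bound and nonnegativity leave only a finite value [S]. *)
move: le_B leS; case: (\sum_(0 <= n <oo) _)%E => [S _ leS _| |] //.
rewrite lee_fin mulrC ler_pdivrMr// mulrC.
suff : rdot dot x x <= B' / 2 * S + rnorm x ^+ 2 / 2 by rewrite rdotxx//; lra.
apply: (@closed_cvg _ _ \oo _ (fun n => rdot dot (series (mixed_term h g x) n) x)
  [set r | r <= B' / 2 * S + rnorm x ^+ 2 / 2]).
- exact: closed_le.
- apply: nearW => n /=; rewrite (le_trans (rdot_mixed_le _ _ _ _ _ B0'))// lerD//.
    by rewrite ler_wpM2l ?divr_ge0 ?(ltW B0')// -lee_fin -sumEFin leS.
  rewrite mulrAC ler_wpM2r// mulrC ler_pdivrMr// mulrC.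
  by rewrite gB// iota_uniq.
- exact: rdot_cvg.
Qed.

(** Pairing the sum [z] with itself gives [‖z‖^2 <= B' B ‖x‖^2 / 2 + ‖z‖^2 / 2]. *)
Lemma bessel_bounded_sums h g (B B' : R) x : 0 < B -> 0 < B' ->
  bessel h B -> bessel g B' ->
  bounded_sums (mixed_term h g x) (Num.sqrt (B' * B) * rnorm x).
Proof.
move=> B0 B0' hB gB s su; set z := \sum_(n <- s) _.
have := rdot_mixed_le h g x z s B0'; rewrite -/z rdotxx// => le_z.
have le_h : B' / 2 * (\sum_(n <- s) rnorm (dot x (h n)) ^+ 2) <=
    B' / 2 * (B * rnorm x ^+ 2).
  by rewrite ler_wpM2l ?hB// divr_ge0// ltW.
have le_g : B'^-1 / 2 * (\sum_(n <- s) rnorm (dot z (g n)) ^+ 2) <=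
    rnorm z ^+ 2 / 2.
  by rewrite mulrAC ler_wpM2r// mulrC ler_pdivrMr// mulrC gB.
have BB : 0 <= B' * B by rewrite mulr_ge0 ?ltW.
rewrite -(ler_pXn2r (n := 2)) ?nnegrE ?mulr_ge0 ?rnorm_ge0 ?sqrtr_ge0//.
rewrite exprMn sqr_sqrtr// -mulrA.
have -> : B' * (B * rnorm x ^+ 2) = 2 * (B' / 2 * (B * rnorm x ^+ 2)) by field.
lra.
Qed.

End Reconstruction.

(** * Passage to the normalized sequences *)

Section NormalizedDualFrames.
Variables (R : realType) (k : scalar_kind).
Local Notation K := (scalar_field R k).
Variables (H : completeNormedModType K) (dot : {dot H for @scalar_conj R k}).
Hypothesis dot_norm : induces_norm dot.
Variables f g : nat -> H.

Lemma minimal_norm_product_ge1 : reconstructs dot f g -> minimal_seq g ->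
  forall n, 1 <= rnorm (f n) * rnorm (g n).
Proof.
move=> fg gmin n; rewrite mulrC.
rewrite (le_trans _ (rdot_cauchy_schwarz dot_norm _ _))//.
by rewrite /rdot (minimal_biorthogonal (fg (g n)).1 gmin) scalar_re1 normr1.
Qed.

Let h n := `|g n| *: f n.
Let u n := `|g n|^-1 *: g n.

Lemma mixed_term_normalized x : (forall n, g n != 0) ->
  mixed_term dot h u x = mixed_term dot f g x.
Proof.
move=> g0; apply/funext => n; rewrite /mixed_term /h /u dotZr scalar_conj_norm.
by rewrite scalerA mulrAC divff ?normr_eq0// mul1r.
Qed.

Lemma mixed_term_normalized_swap x : (forall n, g n != 0) ->
  mixed_term dot u h x = mixed_term dot g f x.
Proof.
move=> g0; apply/funext => n; rewrite /mixed_term /h /u dotZr.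
have := scalar_conj_norm (`|g n|^-1); rewrite normfV normr_id => ->.
by rewrite scalerA mulrAC mulVf ?normr_eq0// mul1r.
Qed.

Lemma reconstructs_dual_frames (d : R) : 0 < d ->
  (forall n, d <= rnorm (f n) * rnorm (g n)) -> reconstructs dot f g ->
  (forall n, g n != 0) /\ dual_frames dot h u.
Proof.
move=> d0 dfg fg.
have g0 n : g n != 0.
  by apply: contraTneq (dfg n) => ->; rewrite rnorm0 mulr0 leNgt d0.
split=> //; have gf := reconstructs_swap dot_norm fg.
have [C fgC] := reconstructs_bounded dot_norm fg.
have gfC := bounded_sums_swap dot_norm fgC.
(* The modulus of [dot x (h n)] is the norm of [mixed_term dot f g x n]; adding [1] makes the
   constant positive. *)
have hB : bessel dot h ((2 * C) ^+ 2 + 1).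
  apply: (@bessel_weaken _ _ _ _ _ ((2 * C) ^+ 2)); first by rewrite lerDl.
  move=> x s su; rewrite -exprMn -mulrA.
  rewrite (le_trans _ (bounded_sums_sqr dot_norm (fgC x) su))//.
  apply: ler_sum => n _; rewrite lerXn2r ?nnegrE ?rnorm_ge0//.
  by rewrite /h dotZr scalar_conj_norm rnormM rnormZ rnorm_norm mulrC.
(* Since [d / ‖g n‖ <= ‖f n‖], [d] times the modulus of [dot x (u n)] is at most the norm of
   [mixed_term dot g f x n]. *)
have uB : bessel dot u ((2 * C) ^+ 2 / d ^+ 2 + 1).
  apply: (@bessel_weaken _ _ _ _ _ ((2 * C) ^+ 2 / d ^+ 2)); first by rewrite lerDl.
  move=> x s su; rewrite mulrAC ler_pdivlMr ?exprn_gt0// -exprMn -[_ * C * _]mulrA.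
  rewrite mulr_suml (le_trans _ (bounded_sums_sqr dot_norm (gfC x) su))//.
  apply: ler_sum => n _; rewrite -exprMn.
  rewrite lerXn2r ?nnegrE ?mulr_ge0 ?rnorm_ge0 ?(ltW d0)//.
  rewrite /u dotZr rnormM rnorm_conj rnormV rnorm_norm rnormZ.
  rewrite mulrAC [leRHS]mulrC ler_wpM2r ?rnorm_ge0//.
  by rewrite mulrC ler_pdivrMr ?rnorm_gt0.
have pos (a : R) : 0 <= a -> 0 < a + 1 by move=> a0; rewrite ltr_wpDl.
have B0 : 0 < (2 * C) ^+ 2 + 1 by rewrite pos ?sqr_ge0.
have B0' : 0 < (2 * C) ^+ 2 / d ^+ 2 + 1 by rewrite pos ?divr_ge0 ?sqr_ge0.
have hu x : series (mixed_term dot h u x) @ \oo --> x.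
  by rewrite mixed_term_normalized//; have [] := fg x.
have uh x : series (mixed_term dot u h x) @ \oo --> x.
  by rewrite mixed_term_normalized_swap//; have [] := gf x.
split; last by move=> x; split; [exact: hu|exact: uh].
- exact: (bessel_frame dot_norm B0 B0' hB uB hu).
- exact: (bessel_frame dot_norm B0' B0 uB hB uh).
Qed.

(** Normalization leaves the mixed terms unchanged, so the Bessel bounds of [h] and [u] control the
    finite sums for [f] and [g]. *)
Lemma dual_frames_reconstructs :
  (forall n, g n != 0) -> dual_frames dot h u -> reconstructs dot f g.
Proof.
move=> g0 [/frame_bessel[B B0 hB] /frame_bessel[B' B0' uB] hu] x.
have := bessel_bounded_sums dot_norm x B0 B0' hB uB.
rewrite mixed_term_normalized// => fgC; split.
  by rewrite -mixed_term_normalized//; have [] := hu x.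
by move=> s /bij_inj; exact: (bounded_sums_rearrangement dot_norm fgC).
Qed.

End NormalizedDualFrames.

Lemma norm_product_gt0 (R : realType) (k : scalar_kind)
    (H : completeNormedModType (scalar_field R k))
    (dot : {dot H for @scalar_conj R k}) (f g : nat -> H) :
  induces_norm dot -> reconstructs dot f g ->
  0 < inf (range (fun n => rnorm (f n) * rnorm (g n)))
    \/ minimal_seq g \/ minimal_seq f ->
  exists2 d : R, 0 < d & forall n, d <= rnorm (f n) * rnorm (g n).
Proof.
move=> dot_norm fg [d0|[gmin|fmin]].
- exists (inf (range (fun n => rnorm (f n) * rnorm (g n)))) => // n.
  apply: ge_inf; last by exists n.
  by exists 0 => _ [m _ <-]; rewrite mulr_ge0 ?rnorm_ge0.
- by exists 1 => //; exact: (minimal_norm_product_ge1 dot_norm).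
- exists 1 => // n; rewrite mulrC.
  exact: (minimal_norm_product_ge1 dot_norm (reconstructs_swap dot_norm fg)).
Qed.

Theorem proposition4p13 (R : realType) (k : scalar_kind)
    (H : completeNormedModType (scalar_field R k))
    (dot : {dot H for @scalar_conj R k})
    (dot_norm : induces_norm dot)
    (H_infinite : infinite_dimensional H) (H_separable : separable_space H)
    (f g : nat -> H)
    (fg : 0 < inf (range (fun n => rnorm (f n) * rnorm (g n)))
          \/ minimal_seq g \/ minimal_seq f) :
  let statement1 := forall x : H,
    unconditionally_sums_to (fun n => dot x (f n) *: g n) x in
  let statement2 := (forall n, g n != 0) /\
    dual_frames dot (fun n => `|g n| *: f n) (fun n => `|g n|^-1 *: g n) in
  let statement3 := (forall n, f n != 0) /\
    dual_frames dot (fun n => `|f n| *: g n) (fun n => `|f n|^-1 *: f n) in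
  (statement1 <-> statement2) /\ (statement2 <-> statement3).
Proof.
move=> statement1 statement2 statement3.
have s12 : statement1 -> statement2.
  move=> s1; have [d d0 dfg] := norm_product_gt0 dot_norm s1 fg.
  exact: (reconstructs_dual_frames dot_norm d0 dfg s1).
have s21 : statement2 -> statement1.
  by case=> g0 gf; exact: (dual_frames_reconstructs dot_norm g0 gf).
(* [statement3] is [statement2] with [f] and [g] exchanged, and reconstruction is symmetric in the
   two. *)
have s13 : statement1 -> statement3.
  move=> s1; have [d d0 dfg] := norm_product_gt0 dot_norm s1 fg.
  apply: (reconstructs_dual_frames dot_norm d0 _ (reconstructs_swap dot_norm s1)).
  by move=> n; rewrite mulrC.
have s31 : statement3 -> statement1.
  case=> f0 fg'; apply: (reconstructs_swap dot_norm).
  exact: (dual_frames_reconstructs dot_norm f0 fg').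
by split; [split|split=> [/s21/s13|/s31/s12]].
Qed.
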